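(* For any $k\ge 2$, any $l\in\mathbb{Q}^k_{>0}$ and any $k$-dimensional lattice $\Lambda\subset\mathbb{Z}^k$, $$\mathrm{gap}(\Lambda,l)\ \le\ \frac{k\,\gamma_k^{k/2}\,\det(\Lambda)\left(\sum_{i=1}^k l_i+|l|\right)}{2}-\sum_{i=1}^k l_i ,$$ where $|\cdot|$ is the Euclidean norm and $\gamma_k$ is the $k$-dimensional Hermite constant.
   Context: For a $k$-dimensional lattice $\Lambda\subset\mathbb{Z}^k$, $l\in\mathbb{Q}^k_{>0}$ and $r\in\mathbb{Z}^k$, let $m(\Lambda,l,r)=\min\{l\cdot x: x\in\mathbb{Z}^k,\ x-r\in\Lambda,\ x\ge 0\}$ (coordinatewise inequality). The lattice programming gap is $\mathrm{gap}(\Lambda,l)=\max_{r\in\mathbb{Z}^k}m(\Lambda,l,r)$. The Hermite constant $\gamma_k$ is the infimum of the constants $\gamma'$ such that every positive definite real quadratic form $\sum f_{ij}x_ix_j$ in $k$ variables (with symmetric coefficient matrix $(f_{ij})$) takes, at some nonzero integer vector, a value $\le\gamma'\,|\det(f_{ij})|^{1/k}$. *)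

(* Defs.v *)
From HB Require Import structures.
From mathcomp Require Import all_boot all_order all_algebra.
From mathcomp Require Import all_classical all_reals all_analysis.

Set Implicit Arguments.
Unset Strict Implicit.
Unset Printing Implicit Defensive.

Import Order.TTheory GRing.Theory Num.Theory.
Local Open Scope classical_set_scope.
Local Open Scope ring_scope.

Section Lattices.
Context {k : nat}.

(* The lattice vectors are the integer combinations of the rows of [B]. *)
Definition lattice_basis (L : set 'rV[int]_k) (B : 'M[int]_k) : Prop :=
  \det B != 0 /\ L = [set z *m B | z in [set: 'rV[int]_k]].

Definition full_lattice (L : set 'rV[int]_k) : Prop :=
  exists B, lattice_basis L B.

(* By [latdetE] below, the value does not depend on the basis chosen here. *)
Definition latdet (L : set 'rV[int]_k) : nat :=
  `|\det (xget 0%R [set B | lattice_basis L B])|%N.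

End Lattices.

Section Gap.
Context {R : realType} {k : nat}.

Definition lprog_cost (l : 'rV[rat]_k) (x : 'rV[int]_k) : R :=
  \sum_(i < k) ratr (l 0 i) * (x 0 i)%:~R.

Definition lprog_feasible (L : set 'rV[int]_k) (r : 'rV[int]_k) :
    set 'rV[int]_k :=
  [set x | L (x - r) /\ forall i, 0 <= x 0 i].

(* Extended reals make the two extrema total; for a full-dimensional lattice
   and a positive cost vector they are attained, see [lprog_min_attained] and
   [lprog_gap_attained]. *)
Definition lprog_min (L : set 'rV[int]_k) (l : 'rV[rat]_k) (r : 'rV[int]_k) :
    \bar R :=
  ereal_inf [set (lprog_cost l x)%:E | x in lprog_feasible L r].

Definition lprog_gap (L : set 'rV[int]_k) (l : 'rV[rat]_k) : \bar R :=
  ereal_sup [set lprog_min L l r | r in [set: 'rV[int]_k]].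

End Gap.

Section Hermite.
Context {R : realType}.

Definition qform k (F : 'M[R]_k) (x : 'rV[R]_k) : R :=
  \sum_(i < k) \sum_(j < k) F i j * x 0 i * x 0 j.

Definition posdef k (F : 'M[R]_k) : Prop :=
  F^T = F /\ forall x : 'rV[R]_k, x != 0 -> 0 < qform F x.

Definition hermite_bound k (g : R) : Prop :=
  forall F : 'M[R]_k, posdef F ->
    exists2 z : 'rV[int]_k, z != 0 &
      qform F (map_mx intr z) <= g * `|\det F| `^ (k%:R^-1).

Definition hermite_const k : R := inf [set g | hermite_bound k g].

End Hermite.

Arguments hermite_const : clear implicits.

Definition enorm {R : realType} k (l : 'rV[rat]_k) : R :=
  Num.sqrt (\sum_(i < k) ratr (l 0 i) ^+ 2).

Lemma latdetE k (L : set 'rV[int]_k) (B : 'M[int]_k) :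
  lattice_basis L B -> latdet L = `|\det B|%N.
Proof.
move=> LB; rewrite /latdet; case: xgetP => [C _ LC|/(_ B)//].
have key (B1 B2 : 'M[int]_k) : lattice_basis L B1 -> lattice_basis L B2 ->
    (`|\det B1| %| `|\det B2|)%N.
  move=> [_ e1] [_ e2].
  have h i : exists z : 'rV[int]_k, z *m B1 = row i B2.
    have : L (row i B2) by rewrite e2; exists (delta_mx 0 i); rewrite // rowE.
    by rewrite e1 => -[z _ <-]; exists z.
  have [f fP] := boolp.choice h.
  have -> : B2 = (\matrix_i f i) *m B1.
    by apply/row_matrixP => i; rewrite row_mul rowK fP.
  by rewrite det_mulmx abszM dvdn_mull.
by apply/eqP; rewrite eqn_dvd !key.
Qed.

Section Attained.
Context {R : realType} {k : nat}.
Context (L : set 'rV[int]_k) (l : 'rV[rat]_k).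
Context (latL : full_lattice L).
Context (l_gt0 : forall i, 0 < l 0 i).

Let latD x y : L x -> L y -> L (x + y).
Proof.
case: latL => B [_ ->] [u _ <-] [v _ <-].
by exists (u + v); rewrite // mulmxDl.
Qed.

Let latN x : L x -> L (- x).
Proof.
by case: latL => B [_ ->] [u _ <-]; exists (- u); rewrite // mulNmx.
Qed.

Let lat_mul : exists2 N : nat, (0 < N)%N & forall v, L (N%:Z *: v).
Proof.
case: latL => B [B0 ->]; exists `|\det B|%N; first by rewrite absz_gt0.
move=> v; exists (((-1) ^+ (\det B < 0)%R *: v) *m \adj B) => //.
by rewrite -mulmxA mul_adj_mx mul_mx_scalar scalerA abszE normrEsign mulrC.
Qed.

Let feasible_neq0 r : exists x, lprog_feasible L r x.
Proof.
have [N N0 LN] := lat_mul.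
exists (r + N%:Z *: \row_i `|r 0 i|); split; first by rewrite addrC addKr.
move=> i; rewrite !mxE -lerBlDl sub0r (le_trans (ler_norm _))// normrN.
by rewrite ler_peMl// -[1]/(1%:Z) lez_nat.
Qed.

Let cost_nat : exists2 D : nat, (0 < D)%N &
  forall x : 'rV[int]_k, (forall i, 0 <= x 0 i) ->
    exists n : nat, lprog_cost l x = n%:R / D%:R :> R.
Proof.
pose D := (\prod_i `|denq (l 0%R i)|)%N.
have D0 : (0 < D)%N by apply: prodn_gt0 => i; rewrite absz_gt0 denq_neq0.
exists D => // x x0.
pose c i := (`|numq (l 0%R i)| * \prod_(j | j != i) `|denq (l 0%R j)|)%N.
exists (\sum_i c i * `|x 0%R i|)%N.
rewrite /lprog_cost natr_sum mulr_suml; apply: eq_bigr => i _.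
have intE (z : int) : 0 <= z -> z%:~R = `|z|%N%:R :> R.
  by move=> z0; rewrite -{1}(gez0_abs z0) -pmulrn.
have -> : ratr (l 0 i) = (c i)%:R / D%:R :> R.
  rewrite /c /D [X in _ / X%:R](bigD1 i)//= !natrM invfM mulrACA divff ?mulr1; last first.
    by rewrite pnatr_eq0 -lt0n prodn_gt0// => j; rewrite absz_gt0 denq_neq0.
  by rewrite /ratr !intE ?denq_ge0// ltW// numq_gt0.
by rewrite natrM mulrAC intE.
Qed.

Lemma lprog_min_attained r : exists2 x, lprog_feasible L r x &
  lprog_min L l r = (lprog_cost l x)%:E :> \bar R.
Proof.
have [D D0 costD] := cost_nat.
pose P n := `[< exists2 x, lprog_feasible L r x &
                  lprog_cost l x = n%:R / D%:R :> R >].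
have exP : exists n, P n.
  have [x fx] := feasible_neq0 r; have [n xn] := costD x fx.2.
  by exists n; apply/asboolP; exists x.
case: (ex_minnP exP) => n /asboolP[x fx xn] nmin; exists x => //.
apply/eqP; rewrite eq_le; apply/andP; split.
  by apply: ereal_inf_lbound; exists x.
apply/ereal_infP => _ [y fy <-]; rewrite lee_fin xn.
have [p yp] := costD y fy.2; rewrite yp ler_pM2r ?invr_gt0 ?ltr0n//.
by rewrite ler_nat nmin//; apply/asboolP; exists y.
Qed.

Lemma lprog_gap_attained :
  exists r, lprog_gap L l = lprog_min L l r :> \bar R.
Proof.
have [N N0 LN] := lat_mul; case: N N0 LN => // N _ LN.
have periodic r s : L (r - s) -> lprog_min L l r = lprog_min L l s :> \bar R.
  move=> rs; congr (ereal_inf (image _ _)); apply/seteqP.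
  split => x [Lx x0]; split => //.
    by have := latD Lx rs; rewrite addrA subrK.
  by have := latD Lx (latN rs); rewrite opprB addrA subrK.
pose m (f : {ffun 'I_k -> 'I_N.+1}) : \bar R :=
  lprog_min L l (\row_i (f i)%:Z).
pose f0 := [arg max_(f > [ffun=> ord0] : {ffun 'I_k -> 'I_N.+1}) m f]%O.
exists (\row_i (f0 i)%:Z); apply/eqP; rewrite eq_le; apply/andP; split.
  apply/ereal_supP => _ [r _ <-].
  pose f := [ffun i => inord `|(r 0%R i %% N.+1)%Z|%N : 'I_N.+1].
  have -> : lprog_min L l r = m f.
    apply: periodic.
    have -> : r - \row_i (f i)%:Z = N.+1%:Z *: \row_i (r 0%R i %/ N.+1)%Z.
      apply/rowP => i; rewrite !mxE ffunE inordK; last first.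
        by rewrite -ltz_nat gez0_abs ?modz_ge0// ltz_pmod.
      by rewrite gez0_abs ?modz_ge0// {1}(divz_eq (r 0 i) N.+1) addrK mulrC.
    exact: LN.
  by rewrite -/(m f0) /f0; case: arg_maxP => // g _; apply.
by apply: ereal_sup_ubound; exists (\row_i (f0 i)%:Z).
Qed.

End Attained.

(* Main.v *)
(* A ball of radius rho fits in the simplex x >= 0, l.x <= rho (sum l + |l|),
   and an integral point with all coordinates > -1 is nonnegative; so it is
   enough to show that every point of R^k is within rho = k/2 gamma^(k/2) det L
   of L. By rounding coordinates this holds once L contains k independent
   vectors of norm at most M = gamma^(k/2) det L. Otherwise all such vectors lie
   in a hyperplane u^perp. Let N be the least integer > M^2; since square norms
   on L are integers, the form |x|^2 - (1 - 1/N) (x.u)^2/|u|^2 is at least 1 on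
   L \ {0}: by integrality on u^perp, by Cauchy-Schwarz off it. Its determinant
   on L is det(L)^2/N < gamma^(-k), contradicting the definition of gamma.
   As the infimum of the empty set is 0, this also requires that some Hermite
   bound exists, which is Hermite's reduction argument. *)
Require Import Defs.
From HB Require Import structures.
From mathcomp Require Import all_boot all_order all_algebra all_fingroup.
From mathcomp Require Import all_classical all_reals all_analysis.
From mathcomp Require Import zify ring lra.

Import Order.TTheory GRing.Theory Num.Theory.
Local Open Scope classical_set_scope.
Local Open Scope ring_scope.

Section LatticeCovering.
Context {R : realType}.

(** * Quadratic forms, congruence and completion of the square *)

Lemma qformE {n} {F : 'M[R]_n} (x : 'rV[R]_n) :
  qform F x = (x *m F *m x^T) 0 0.
Proof.
rewrite /qform exchange_big mxE; apply: eq_bigr => j _.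
rewrite !mxE mulr_suml; apply: eq_bigr => i _.
by rewrite (mulrC (F i j)).
Qed.

Lemma qform_congr {m n} (F : 'M[R]_n) (A : 'M[R]_(m, n)) (x : 'rV[R]_m) :
  qform (A *m F *m A^T) x = qform F (x *m A).
Proof. by rewrite !qformE trmx_mul !mulmxA. Qed.

Lemma posdef_congr {n} {F A : 'M[R]_n} :
  A \in unitmx -> posdef F -> posdef (A *m F *m A^T).
Proof.
move=> uA [FT Fpos]; split; first by rewrite !trmx_mul trmxK FT mulmxA.
move=> x x0; rewrite qform_congr; apply: Fpos; apply: contra_neq x0 => xA0.
by rewrite -(mulmxK uA x) xA0 mul0mx.
Qed.

Lemma qform_delta {n} {F : 'M[R]_n} i : qform F (delta_mx 0 i) = F i i.
Proof. by rewrite qformE trmx_delta -rowE -colE !mxE. Qed.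

Lemma posdef_diag_gt0 {n} {F : 'M[R]_n} i : posdef F -> 0 < F i i.
Proof.
move=> [_ Fpos]; rewrite -qform_delta; apply: Fpos.
by apply/eqP => /rowP/(_ i)/eqP; rewrite !mxE !eqxx oner_eq0.
Qed.

Lemma qform_diag_block {n} (a : 'M[R]_1) (G : 'M[R]_n) (x : 'rV[R]_1)
    (y : 'rV[R]_n) :
  qform (block_mx a 0 0 G) (row_mx x y) = a 0 0 * x 0 0 ^+ 2 + qform G y.
Proof.
rewrite !qformE mul_row_block !mulmx0 addr0 add0r tr_row_mx mul_row_col mxE.
by congr (_ + _); rewrite mxE big_ord1 mxE big_ord1 mxE expr2 mulrCA mulrA.
Qed.

Definition schur {n} (F : 'M[R]_(1 + n)) : 'M[R]_n :=
  drsubmx F - (F 0 0)^-1 *: ((ursubmx F)^T *m ursubmx F).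

Definition shear {n} (F : 'M[R]_(1 + n)) : 'M[R]_(1 + n) :=
  block_mx 1%:M 0 ((F 0 0)^-1 *: (ursubmx F)^T) 1%:M.

Lemma det_shear {n} {F : 'M[R]_(1 + n)} : \det (shear F) = 1.
Proof. by rewrite det_lblock !det1 mulr1. Qed.

Lemma schurP {n} {F : 'M[R]_(1 + n)} : posdef F ->
  F = shear F *m block_mx (F 0 0)%:M 0 0 (schur F) *m (shear F)^T.
Proof.
move=> pF; have a0 : F 0 0 != 0 by rewrite gt_eqF// posdef_diag_gt0.
have [FT _] := pF.
rewrite /shear tr_block_mx !mulmx_block !trmx1 !trmx0.
rewrite !(mul0mx, mulmx0, mul1mx, mulmx1).
rewrite !(addr0, add0r) linearZ/= trmxK mul_scalar_mx -!scalemxAl mul_mx_scalar.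
rewrite !scalerA divff// !scale1r -scalemxAr mulVf// scale1r.
rewrite -{1}(submxK F); congr block_mx.
- by rewrite [LHS]mx11_scalar !mxE; congr (F _ _)%:M; apply: val_inj.
- by rewrite trmx_ursub FT.
- by rewrite -scalemxAl [_^-1 *: (F 0 0 *: _)]scalerA mulVf// scale1r
    addrC subrK.
Qed.

Lemma det_schur {n} {F : 'M[R]_(1 + n)} : posdef F ->
  \det F = F 0 0 * \det (schur F).
Proof.
move=> pF; rewrite {1}(schurP pF) !det_mulmx det_tr det_shear mul1r mulr1.
by rewrite det_ublock det_scalar1.
Qed.

Lemma qform_schur {n} {F : 'M[R]_(1 + n)} (x : 'rV[R]_1) (y : 'rV[R]_n) :
  posdef F ->
  qform F (row_mx x y) =
  F 0 0 * (x 0 0 + (F 0 0)^-1 * (y *m (ursubmx F)^T) 0 0) ^+ 2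
    + qform (schur F) y.
Proof.
move=> pF; rewrite {1}(schurP pF) qform_congr mul_row_block.
rewrite !mulmx1 !mulmx0 add0r.
by rewrite qform_diag_block -scalemxAr !mxE mulr1n.
Qed.

(** The value of [schur F] at [y] is the value of [F] at [y] preceded by the coordinate [- t], which
    makes the completed square vanish. *)
Lemma posdef_schur {n} {F : 'M[R]_(1 + n)} : posdef F -> posdef (schur F).
Proof.
move=> pF; have [FT Fpos] := pF; split.
  rewrite linearB linearZ/= trmx_mul trmxK -[in RHS]FT.
  by rewrite /schur trmx_drsub FT.
move=> y y0.
set t := (F 0 0)^-1 * (y *m (ursubmx F)^T) 0 0.
have : 0 < qform F (row_mx (- t)%:M y).
  apply: Fpos; apply: contra_neq y0 => /(congr1 rsubmx).
  by rewrite row_mxKr => ->; rewrite linear0.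
by rewrite qform_schur// mxE mulr1n -/t addNr expr0n mulr0 add0r.
Qed.

(** Induction by completing the square replaces compactness: a nonzero tail of [z] is handled by
    [schur F]; otherwise the first coordinate is a nonzero integer and the value is at least
    [F 0 0]. *)
Lemma posdef_lower_bound {n} {F : 'M[R]_n} : posdef F ->
  exists2 c : R, 0 < c &
    forall z : 'rV[int]_n, z != 0 -> c <= qform F (map_mx intr z).
Proof.
elim: n F => [|n IH] F pF.
  by exists 1 => // z; rewrite [z]thinmx0 eqxx.
have [c c0 cP] := IH _ (posdef_schur pF).
have a0 : 0 < F 0 0 by apply: posdef_diag_gt0.
exists (Num.min c (F 0 0)); first by rewrite lt_min c0 a0.
move=> z z0.
have -> : map_mx intr z = row_mx (map_mx intr (lsubmx (z : 'rV_(1 + n))))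
    (map_mx intr (rsubmx (z : 'rV_(1 + n)))) :> 'rV[R]_(1 + n).
  by rewrite -map_row_mx hsubmxK.
rewrite qform_schur//.
have [r0|r0] := eqVneq (rsubmx (z : 'rV_(1 + n))) 0; last first.
  rewrite ge_min; apply/orP; left; apply: (le_trans (cP _ r0)).
  by rewrite lerDr mulr_ge0 ?sqr_ge0// ltW.
have qform0 : qform (schur F) 0 = 0 by rewrite qformE !mul0mx mxE.
rewrite r0 map_mx0 mul0mx qform0 !mxE mulr0 !addr0 ge_min; apply/orP; right.
rewrite ler_peMr ?(ltW a0)// ?mxE.
have z00 : z 0 (lshift n (0 : 'I_1)) != 0.
  apply: contra_neq z0 => z00; rewrite -(hsubmxK (z : 'rV_(1 + n))) r0.
  have -> : lsubmx (z : 'rV_(1 + n)) = 0.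
    by apply/rowP => i; rewrite !mxE ord1.
  by rewrite row_mx0.
rewrite -rmorphXn/= -[1]/(1%:~R) ler_int.
by rewrite -gtz0_ge1 lt_def sqr_ge0 sqrf_eq0 z00.
Qed.

(** * Unimodular matrices and Hermite's reduction *)

Lemma det_unimodular_sqr {n} (U : 'M[int]_n) :
  U \in unitmx -> \det (map_mx intr U : 'M[R]_n) ^+ 2 = 1.
Proof.
rewrite unitmxE det_map_mx => /orP[] /eqP ->;
  by rewrite ?rmorphN1 ?sqrrN expr1n.
Qed.

Lemma unimodular_row_neq0 {n} (U : 'M[int]_n) i : U \in unitmx -> row i U != 0.
Proof.
move=> uU; apply/eqP => r0; have := mulmxK uU (delta_mx 0 i : 'rV_n).
rewrite -rowE r0 mul0mx => /rowP/(_ i)/eqP.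
by rewrite !mxE !eqxx eq_sym oner_eq0.
Qed.

(** Swapping two rows of a block triangular matrix suffices. In the reduction this lifts a short
    vector of the Schur complement with a first coordinate of choice. *)
Lemma unimodular_extend {n} (m : int) {W : 'M[int]_n.+1} : W \in unitmx ->
  exists2 V : 'M[int]_(1 + n.+1), V \in unitmx &
    row 0 V = row_mx m%:M (row 0 W).
Proof.
move=> uW; pose B : 'M[int]_(1 + n.+1) := block_mx 1%:M 0 (const_mx m) W.
exists (xrow 0 (rshift 1 (0 : 'I_n.+1)) B : 'M[int]_n.+2).
  rewrite xrowE unitmx_mul unitmx_perm/=.
  by rewrite unitmxE det_lblock det1 mul1r -unitmxE.
have -> : row 0 (xrow 0 (rshift 1 (0 : 'I_n.+1)) B : 'M[int]_n.+2) =
    row (rshift 1 0) B.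
  rewrite /xrow; apply/rowP => j; rewrite mxE [RHS]mxE mxE; congr (B _ j).
  have -> : (0 : 'I_n.+2) = lshift n.+1 (0 : 'I_1) by apply: val_inj.
  exact: tpermL.
rewrite /B rowKd row_row_mx; congr row_mx.
by apply/rowP => i; rewrite !mxE ord1.
Qed.

(* Hermite's induction, kept free of roots. The minimum of [F] is searched only
   among first rows of unimodular matrices, so that no completion of primitive
   vectors is needed, and it is only reached up to the factor 2. *)
Lemma hermite_reduction n : exists2 C : R, 0 < C &
  forall F : 'M[R]_n.+1, posdef F -> exists2 U : 'M[int]_n.+1, U \in unitmx &
    qform F (map_mx intr (row 0 U)) ^+ n.+1 <= C * \det F.
Proof.
elim: n => [|n [C C0 IH]].
  exists 1 => // F pF; exists 1%:M; rewrite ?unitmx1//.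
  have -> : row 0 (1%:M : 'M[int]_1) = delta_mx 0 0.
    by rewrite -[RHS]mulmx1 -rowE.
  by rewrite map_delta_mx qform_delta expr1 mul1r {2}(mx11_scalar F)
    det_scalar1.
exists (4%:R ^+ n.+1 * C); first by rewrite mulr_gt0 ?exprn_gt0.
move=> F pF.
pose q (U : 'M[int]_n.+2) : R := qform F (map_mx intr (row 0 U)).
have [c c0 cP] := posdef_lower_bound pF.
pose S := [set q U | U in [set U | U \in unitmx]].
have qS : S (q 1%:M) by exists 1%:M => //=; rewrite unitmx1.
have lbS : lbound S c by move=> _ [U uU <-]; apply/cP/unimodular_row_neq0.
have infS : has_inf S by split; [exists (q 1%:M) | exists c].
have S0 : 0 < inf S.
  by apply: (lt_le_trans c0); apply: lb_le_inf => //; exists (q 1%:M).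
(* The infimum is positive, so it can serve as its own error term: [q U] is below twice the
   infimum. *)
have [_ [U uU <-] qU] := inf_adherent S0 infS.
have qmin V : V \in unitmx -> q U <= 2 * q V.
  move=> uV; rewrite (le_trans (ltW qU))// -mulr2n mulr_natl lerMn2r/=.
  by apply: ge_inf; [exists c | exists V].
exists U => //; rewrite -/(q U).
pose UR : 'M[R]_n.+2 := map_mx intr U.
have uUR : UR \in unitmx by rewrite unitmxE det_map_mx rmorph_unit -?unitmxE.
pose G : 'M[R]_(1 + n.+1) := UR *m F *m UR^T.
have pG : posdef G by apply: posdef_congr.
have detG : \det G = \det F.
  by rewrite !det_mulmx det_tr mulrAC -expr2 det_unimodular_sqr// mul1r.
have G00 : G 0 0 = q U.
  by rewrite -qform_delta qform_congr -rowE -map_row.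
have [W uW HW] := IH _ (posdef_schur pG).
set w := row 0 W in HW.
pose t := (G 0 0)^-1 * (map_mx intr w *m (ursubmx G)^T) 0 0.
(* This rounding puts [m + t] in the interval from -1/2 to 1/2. *)
pose m := Num.floor (2^-1 - t).
have tm : (m%:~R + t) ^+ 2 <= 4^-1 :> R.
  have := floor_itv (2^-1 - t); rewrite -/m.
  move=> /andP[]; rewrite intrD => h1 h2; nra.
have [V uV rV] := unimodular_extend m uW.
have := qmin (V *m U) _; rewrite unitmx_mul uV uU => /(_ isT).
have -> : q (V *m U) = qform G (row_mx m%:~R%:M (map_mx intr w)).
  rewrite /G qform_congr /q row_mul rV map_mxM map_row_mx.
  by rewrite map_scalar_mx.
rewrite qform_schur// -/t -G00.
rewrite [X in X + t](_ : _ = m%:~R) => [qle|]; last by rewrite mxE.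
have G0 : 0 < G 0 0 by apply: posdef_diag_gt0.
(* With [a = G 0 0] and [b] the Schur value, near-minimality gives [a <= 2 (a / 4 + b)], hence
   [a <= 4 b]; this is the origin of the factor [4 ^+ n.+1]. *)
have le4 : G 0 0 <= 4 * qform (schur G) (map_mx intr w).
  by have := ler_wpM2l (ltW G0) tm; lra.
rewrite exprS -detG det_schur//.
rewrite [leRHS]mulrCA ler_pM2l// -mulrA.
apply: le_trans (_ : (4 * qform (schur G) (map_mx intr w)) ^+ n.+1 <= _).
  by rewrite ler_pXn2r// nnegrE ltW// (lt_le_trans G0).
by rewrite exprMn ler_pM2l// exprn_gt0.
Qed.

(** * Square norms and the Hermite constant *)

Lemma posdef_det_gt0 {n} {F : 'M[R]_n} : posdef F -> 0 < \det F.
Proof.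
elim: n F => [|n IH] F pF; first by rewrite det_mx00.
by rewrite (det_schur pF) mulr_gt0 ?IH ?posdef_diag_gt0//; apply: posdef_schur.
Qed.

Definition sqnorm {n} (x : 'rV[R]_n) : R := \sum_i x 0 i ^+ 2.

Lemma sqnorm_ge0 {n} (x : 'rV[R]_n) : 0 <= sqnorm x.
Proof. by apply: sumr_ge0 => i _; apply: sqr_ge0. Qed.

Lemma sqnorm_eq0 {n} (x : 'rV[R]_n) : (sqnorm x == 0) = (x == 0).
Proof.
apply/eqP/eqP => [x0|->]; last first.
  by rewrite /sqnorm big1// => i _; rewrite mxE expr0n.
apply/rowP => i.
have := psumr_eq0P (fun i _ => sqr_ge0 (x 0 i)) x0 (i := i) isT.
by move/eqP; rewrite sqrf_eq0 mxE => /eqP.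
Qed.

Lemma sqnormE {n} (x : 'rV[R]_n) : sqnorm x = (x *m x^T) 0 0.
Proof. by rewrite mxE; apply: eq_bigr => i _; rewrite mxE expr2. Qed.

Lemma posdef1 n : posdef (1%:M : 'M[R]_n).
Proof.
split=> [|x x0]; first exact: trmx1.
by rewrite qformE mulmx1 -sqnormE lt_def sqnorm_eq0 x0 sqnorm_ge0.
Qed.

Lemma hermite_bound_exists k : (0 < k)%N -> exists g : R, hermite_bound k g.
Proof.
case: k => // n _; have [C C0 hC] := hermite_reduction n.
exists (C `^ (n.+1%:R^-1)) => F pF; have [U uU hU] := hC F pF.
have r0 : row 0 U != 0 by apply: unimodular_row_neq0.
exists (row 0 U) => //.
have [c c0 cP] := posdef_lower_bound pF.
have q0 := le_trans (ltW c0) (cP _ r0).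
have d0 := posdef_det_gt0 pF.
rewrite -powRM ?(ltW C0)// gtr0_norm//.
rewrite -[leLHS]powRr1// -[X in _ `^ X <= _](@divff _ n.+1%:R) ?pnatr_eq0//.
rewrite powRrM powR_mulrn// ge0_ler_powR// ?nnegrE ?invr_ge0//.
- by rewrite exprn_ge0.
- by rewrite mulr_ge0// ltW.
Qed.

(** Divided by the root of the determinant, [m] is below every Hermite bound, hence below their
    infimum, the set of bounds being nonempty. *)
Lemma hermite_const_ge k (F : 'M[R]_k) (m : R) : (0 < k)%N -> posdef F ->
    (forall z : 'rV[int]_k, z != 0 -> m <= qform F (map_mx intr z)) ->
  m <= hermite_const R k * \det F `^ (k%:R^-1).
Proof.
move=> k0 pF mP; have d0 := posdef_det_gt0 pF.
have [g hg] := hermite_bound_exists k k0.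
rewrite -ler_pdivrMr ?powR_gt0//; apply: lb_le_inf; first by exists g.
move=> h /(_ F pF)[z z0]; rewrite gtr0_norm// => hz.
by rewrite ler_pdivrMr ?powR_gt0//; apply: le_trans hz; apply: mP.
Qed.

Lemma hermite_const_ge0 k : (0 < k)%N -> 0 <= hermite_const R k.
Proof.
move=> k0; have p1 := posdef1 k.
have := @hermite_const_ge k 1%:M 0 k0 p1; rewrite det1 powR1 mulr1; apply.
have [c c0 cP] := posdef_lower_bound p1.
by move=> z z0; apply: le_trans (cP z z0); apply: ltW.
Qed.

Lemma hermite_const_exp k (F : 'M[R]_k) : (0 < k)%N -> posdef F ->
    (forall z : 'rV[int]_k, z != 0 -> 1 <= qform F (map_mx intr z)) ->
  1 <= hermite_const R k ^+ k * \det F.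
Proof.
move=> k0 pF F1; have h1 := hermite_const_ge k F 1 k0 pF F1.
have := lerXn2r k (ler01 : 1 \is Num.nneg) _ h1.
rewrite nnegrE (le_trans ler01 h1) => /(_ isT); rewrite expr1n exprMn.
rewrite -(@powR_mulrn _ (_ `^ _)) ?powR_ge0// -powRrM.
by rewrite mulVf ?pnatr_eq0 -?lt0n// powRr1// ltW// posdef_det_gt0.
Qed.

(** * Cauchy-Schwarz and the norm squeezed in one direction *)

Lemma sum_Cauchy_Schwarz (I : finType) (f g : I -> R) :
  (\sum_i f i * g i) ^+ 2 <= (\sum_i f i ^+ 2) * (\sum_i g i ^+ 2).
Proof.
set a := \sum_i f i ^+ 2; set c := \sum_i g i ^+ 2; set b := \sum_i f i * g i.
have c0 : 0 <= c by apply: sumr_ge0 => i _; apply: sqr_ge0.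
have : 0 <= \sum_i (c * f i - b * g i) ^+ 2.
  by apply: sumr_ge0 => i _; apply: sqr_ge0.
rewrite (eq_bigr (fun i => c ^+ 2 * f i ^+ 2 - (2 * c * b) * (f i * g i)
  + b ^+ 2 * g i ^+ 2)) => [|i _]; last by ring.
rewrite !big_split/= sumrN -!mulr_sumr -/a -/b -/c => h.
(* The factor [c] can be cancelled unless it is 0, in which case [g] vanishes. *)
have {h} : 0 <= c * (a * c - b ^+ 2) by lra.
have [c00|cn0] := eqVneq c 0; last first.
  by rewrite pmulr_rge0 ?lt_def ?cn0// subr_ge0.
move=> _; have g0 i : g i = 0.
  have := psumr_eq0P (fun i _ => sqr_ge0 (g i)) c00 (i := i) isT.
  by move/eqP; rewrite sqrf_eq0 => /eqP.
by rewrite /b big1 ?expr0n ?mulr0 ?c00 ?mulr0// => i _; rewrite g0 mulr0.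
Qed.

(** Two triangular factorizations of one bordered block matrix are compared. *)
Lemma det_rank1_update {n} (v : 'rV[R]_n) (w : 'cV[R]_n) :
  \det (1%:M - w *m v) = 1 - (v *m w) 0 0.
Proof.
have e : block_mx 1%:M 0 w 1%:M *m block_mx 1%:M v 0 (1%:M - w *m v)
    = block_mx (1%:M : 'M[R]_1) v 0 1%:M *m block_mx (1%:M - v *m w) 0 w 1%:M.
  rewrite !mulmx_block !(mul0mx,mulmx0,mul1mx,mulmx1,addr0,add0r).
  by rewrite addrC subrK subrK.
have := congr1 determinant e.
rewrite !det_mulmx !det_ublock !det_lblock !det1 !(mul1r, mulr1) => ->.
by rewrite det_mx11 !mxE.
Qed.

(* The square norm, divided by [N] in the direction of [u]. *)
Definition squeeze {n} (u : 'rV[R]_n) (N : R) : 'M[R]_n :=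
  1%:M - ((1 - N^-1) / sqnorm u) *: (u^T *m u).

Lemma det_squeeze n (u : 'rV[R]_n) (N : R) : u != 0 ->
  \det (squeeze u N) = N^-1.
Proof.
move=> u0; rewrite /squeeze scalemxAl det_rank1_update -scalemxAr mxE.
by rewrite -sqnormE divfK ?sqnorm_eq0// opprB addrC subrK.
Qed.

Lemma qform_squeeze n (u : 'rV[R]_n) (N : R) (y : 'rV[R]_n) :
  qform (squeeze u N) y =
  sqnorm y - (1 - N^-1) / sqnorm u * (y *m u^T) 0 0 ^+ 2.
Proof.
rewrite qformE /squeeze mulmxBr mulmxBl mulmx1 -scalemxAr -scalemxAl.
rewrite mxE -sqnormE [X in _ + X]mxE [X in - X]mxE; congr (_ - _ * _).
rewrite mulmxA -(mulmxA _ u) mxE big_ord1 expr2; congr (_ * _).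
by rewrite -[in RHS](trmxK y) -trmx_mul [RHS]mxE.
Qed.

(** By Cauchy-Schwarz the subtracted term is at most [(1 - N^-1) * sqnorm y]. *)
Lemma qform_squeeze_ge n (u : 'rV[R]_n) (N : R) (y : 'rV[R]_n) :
  u != 0 -> 1 <= N -> sqnorm y / N <= qform (squeeze u N) y.
Proof.
move=> u0 N1; rewrite qform_squeeze.
have u1 : 0 < sqnorm u by rewrite lt_def sqnorm_eq0 u0 sqnorm_ge0.
have CS : (y *m u^T) 0 0 ^+ 2 <= sqnorm y * sqnorm u.
  rewrite mxE; apply: le_trans (sum_Cauchy_Schwarz _ _ _).
  by under eq_bigr do rewrite mxE.
have N0 : 0 <= (1 - N^-1) / sqnorm u.
  by rewrite divr_ge0 ?sqnorm_ge0// subr_ge0 invf_le1// (lt_le_trans ltr01).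
have := ler_wpM2l N0 CS; rewrite [leRHS]mulrCA divfK ?gt_eqF// => h.
apply: le_trans (_ : sqnorm y - sqnorm y * (1 - N^-1) <= _).
  by rewrite mulrBr mulr1 opprB addrC subrK.
by rewrite lerD2l lerN2.
Qed.

Lemma posdef_squeeze n (u : 'rV[R]_n) (N : R) :
  u != 0 -> 1 <= N -> posdef (squeeze u N).
Proof.
move=> u0 N1; split.
  by rewrite /squeeze linearB linearZ/= trmx1 trmx_mul trmxK.
move=> y y0; apply: lt_le_trans (qform_squeeze_ge _ u N y u0 N1).
by rewrite divr_gt0 ?(lt_le_trans ltr01 N1)// lt_def sqnorm_eq0 y0 sqnorm_ge0.
Qed.

(** * Short independent lattice vectors and the covering radius *)

(** Greedy extension: fewer than [k] independent vectors have a common nonzero normal [u], and if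
    [S] is not orthogonal to [u], a vector of [S] off the hyperplane enlarges the family. *)
Lemma basis_or_orthogonal k (S : set 'rV[R]_k) :
  (exists2 V : 'M[R]_k, V \in unitmx & forall i, S (row i V)) \/
  (exists2 u : 'rV[R]_k, u != 0 & forall v, S v -> (v *m u^T) 0 0 = 0).
Proof.
have [hu|nu] := pselect
  (exists2 u : 'rV[R]_k, u != 0 & forall v, S v -> (v *m u^T) 0 0 = 0).
  by right.
left; suff h j : (j <= k)%N ->
    exists2 V : 'M[R]_(j, k), row_free V & forall i, S (row i V).
  by have [V Vf SV] := h k (leqnn k); exists V; rewrite -?row_free_unit.
elim: j => [_|j IH jk]; first by exists 0; [rewrite /row_free mxrank0|case].
have [V Vf SV] := IH (ltnW jk).
have [u u0 Vu] : exists2 u : 'rV[R]_k, u != 0 & V *m u^T = 0.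
  have : kermx V^T != 0.
    by rewrite -mxrank_eq0 mxrank_ker mxrank_tr (eqP Vf) subn_eq0 -ltnNge.
  case/rowV0Pn => u /sub_kermxP uV u0; exists u => //.
  by apply: trmx_inj; rewrite trmx_mul trmxK uV trmx0.
have [v Sv vu] : exists2 v, S v & (v *m u^T) 0 0 != 0.
  apply: contrapT => nv; apply: nu; exists u => // v Sv.
  by apply: contrapT => /eqP vu; apply: nv; exists v.
rewrite -addn1; exists (col_mx V v); last first.
  move=> i; case: (split_ordP i) => j' ->; rewrite ?rowKu ?rowKd//.
  by rewrite ord1 (_ : row 0 v = v)//; apply/rowP => l; rewrite mxE.
rewrite -kermx_eq0; apply/rowV0P => w.
move=> /sub_kermxP; rewrite -(hsubmxK w) mul_row_col => e.
(* Pairing a linear relation with [u] kills the old vectors, so the coefficient of [v] is 0. *)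
have := congr1 (mulmxr u^T) e.
rewrite /= mulmxDl -!mulmxA Vu mulmx0 add0r mul0mx.
move=> /rowP/(_ 0)/eqP; rewrite [eqbLHS]mxE big_ord1 [eqbRHS]mxE.
rewrite mulf_eq0 (negbTE vu) orbF => /eqP w0.
have r0 : rsubmx w = 0 by apply/rowP => i; rewrite [i]ord1 w0 mxE.
move: e; rewrite r0 mul0mx addr0 => e.
have -> : lsubmx w = 0 by apply: (row_free_inj Vf); rewrite e mul0mx.
by rewrite row_mx0.
Qed.

Lemma map_intr_eq0 n (v : 'rV[int]_n) :
  (map_mx intr v == 0 :> 'rV[R]_n) = (v == 0).
Proof.
apply/eqP/eqP => [/rowP v0|->]; last exact: map_mx0.
apply/rowP => i; have := v0 i.
by rewrite !mxE => /eqP; rewrite intr_eq0 => /eqP.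
Qed.

Lemma sqnorm_intr n (v : 'rV[int]_n) :
  sqnorm (map_mx intr v) = (\sum_i v 0 i ^+ 2)%:~R :> R.
Proof. by rewrite rmorph_sum; apply: eq_bigr => i _; rewrite mxE rmorphXn. Qed.

(** The rows of [Z *m B] are independent lattice vectors but need not generate the lattice. The
    bound, called [M] in the proof, is on square norms. *)
Lemma short_lattice_basis k (B : 'M[int]_k) : (0 < k)%N -> \det B != 0 ->
  exists2 Z : 'M[int]_k, map_mx intr (Z *m B) \in (unitmx : pred 'M[R]_k) &
    forall i, sqnorm (map_mx intr (row i (Z *m B)))
      <= hermite_const R k ^+ k * (\det B)%:~R ^+ 2.
Proof.
move=> k0 B0; set M := _ * _.
have M0 : 0 <= M.
  by rewrite mulr_ge0 ?sqr_ge0// exprn_ge0// hermite_const_ge0.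
pose S := [set v : 'rV[R]_k |
  exists2 z, v = map_mx intr (z *m B) & sqnorm v <= M].
have [[V uV SV]|[u u0 Su]] := basis_or_orthogonal k S.
  have /boolp.choice[f fP] i : exists z, row i V = map_mx intr (z *m B).
    by have [z] := SV i; exists z.
  have VE : V = map_mx intr ((\matrix_i f i) *m B).
    by apply/row_matrixP => i; rewrite -map_row row_mul rowK fP.
  exists (\matrix_i f i); first by rewrite -VE.
  by move=> i; rewrite map_row -VE; have [] := SV i.
exfalso.
pose N : R := (Num.floor M + 1)%:~R.
have MN : M < N by rewrite /N floorD1_gt.
have N1 : 1 <= N by rewrite /N intrD lerDr ler0z floor_ge0.
pose BR : 'M[R]_k := map_mx intr B.
have uBR : BR \in unitmx.
  by rewrite unitmxE det_map_mx unitfE intr_eq0.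
pose F := BR *m squeeze u N *m BR^T.
have pF : posdef F by apply/posdef_congr/posdef_squeeze.
have : 1 <= hermite_const R k ^+ k * \det F.
  apply: hermite_const_exp => // z z0.
  rewrite qform_congr -map_mxM.
  have zB0 : z *m B != 0.
    apply: contra_neq z0 => zB; apply/eqP; rewrite -map_intr_eq0; apply/eqP.
    by rewrite -(mulmxK uBR (map_mx intr z)) -map_mxM zB map_mx0 mul0mx.
  (* A short vector is orthogonal to [u], so its value is its square norm, a positive integer. For a
     long one the square norm is an integer above [M], hence at least [N]. *)
  have [zM|Mz] := leP (sqnorm (map_mx intr (z *m B))) M.
    rewrite qform_squeeze Su; last by exists z.
    rewrite expr0n mulr0 subr0.
    have : sqnorm (map_mx intr (z *m B)) != 0 :> R.
      by rewrite sqnorm_eq0 map_intr_eq0.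
    rewrite sqnorm_intr -[1]/(1%:~R) ler_int intr_eq0 -gtz0_ge1 => h.
    by rewrite lt_def h sumr_ge0// => i _; apply: sqr_ge0.
  apply: le_trans (qform_squeeze_ge _ _ _ _ u0 N1).
  rewrite ler_pdivlMr ?(lt_le_trans ltr01 N1)// mul1r.
  move: Mz; rewrite sqnorm_intr /N ler_int -floor_lt_int.
  by rewrite -lezD1.
(* The determinant is [(\det B) ^+ 2 / N], so the inequality would say [N <= M]. *)
rewrite !det_mulmx det_tr det_map_mx det_squeeze// mulrAC -expr2 mulrA -/M.
rewrite ler_pdivlMr ?(lt_le_trans ltr01 N1)// mul1r.
by rewrite leNgt MN.
Qed.

(** Rounding the coordinates of [y] in the short vectors leaves coefficients of size at most 1/2. *)
Lemma lattice_covering k (B : 'M[int]_k) (y : 'rV[R]_k) :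
    (0 < k)%N -> \det B != 0 ->
  exists z : 'rV[int]_k, sqnorm (map_mx intr (z *m B) - y)
    <= k%:R ^+ 2 / 4 * (hermite_const R k ^+ k * (\det B)%:~R ^+ 2).
Proof.
move=> k0 B0; have [Z uV VM] := short_lattice_basis k B k0 B0.
set M := _ * _ in VM *; set V := map_mx intr (Z *m B) in uV.
pose a := y *m invmx V.
pose n : 'rV[int]_k := \row_i Num.floor (a 0 i + 2^-1).
exists (n *m Z).
have -> : map_mx intr (n *m Z *m B) - y = (map_mx intr n - a) *m V.
  by rewrite mulmxBl mulmxKV// -mulmxA map_mxM.
pose s i := (map_mx intr n - a) 0 i.
have s4 i : s i ^+ 2 <= 4^-1.
  have := floor_itv (a 0 i + 2^-1); rewrite /s !mxE intrD => /andP[] h1 h2.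
  nra.
apply: le_trans (_ : \sum_j k%:R * \sum_i 4^-1 * V i j ^+ 2 <= _).
  apply: ler_sum => j _; rewrite mxE.
  (* Cauchy-Schwarz against the all-ones vector yields one factor [k]; summing over the [k] short
     vectors yields the other. *)
  rewrite (eq_bigr (fun i => 1 * (s i * V i j))) => [|i _]; last by rewrite mul1r.
  apply: le_trans (sum_Cauchy_Schwarz _ _ _) _.
  rewrite (eq_bigr (fun=> 1)) => [|i _]; last by rewrite expr1n.
  rewrite sumr_const card_ord ler_pM2l ?ltr0n//.
  by apply: ler_sum => i _; rewrite exprMn ler_wpM2r// sqr_ge0.
rewrite -mulr_sumr exchange_big/= expr2 -!mulrA ler_pM2l ?ltr0n//.
apply: le_trans (_ : \sum_(i < k) 4^-1 * M <= _); last first.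
  by rewrite sumr_const card_ord mulr_natl.
apply: ler_sum => i _; rewrite -mulr_sumr ler_pM2l ?invr_gt0//.
apply: le_trans (VM i); rewrite le_eqVlt; apply/orP; left; apply/eqP.
by apply: eq_bigr => j _; rewrite map_row [in RHS]mxE.
Qed.

End LatticeCovering.

(** * From covering to the gap *)

Theorem theorem1p3 (R : realType) (k : nat) (hk : (2 <= k)%N)
    (l : 'rV[rat]_k) (hl : forall i, 0 < l 0 i)
    (L : set 'rV[int]_k) (hL : full_lattice L) :
  (lprog_gap L l <=
    (k%:R * hermite_const R k `^ (k%:R / 2) * (latdet L)%:R
       * (\sum_(i < k) ratr (l 0 i) + enorm l) / 2
     - \sum_(i < k) ratr (l 0 i) : R)%:E)%E.
Proof.
have k0 : (0 < k)%N by apply: ltn_trans hk.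
have [B [B0 LE]] := hL.
rewrite (latdetE (conj B0 LE)).
set H := hermite_const R k; set s := \sum_i _; set D : R := `|\det B|%N%:R.
set rho := k%:R / 2 * (H `^ (k%:R / 2) * D).
have rho0 : 0 <= rho by rewrite !mulr_ge0 ?powR_ge0 ?invr_ge0.
have rho2 : k%:R ^+ 2 / 4 * (H ^+ k * (\det B)%:~R ^+ 2) = rho ^+ 2.
  have -> : (\det B)%:~R ^+ 2 = D ^+ 2 :> R.
    by rewrite /D natr_absz intr_norm real_normK ?num_real.
  have -> : H ^+ k = (H `^ (k%:R / 2)) ^+ 2.
    rewrite -(@powR_mulrn _ (_ `^ _)) ?powR_ge0// -powRrM divfK ?pnatr_eq0//.
    by rewrite powR_mulrn// hermite_const_ge0.
  by rewrite /rho; field.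
have s0 : 0 < s.
  rewrite /s (bigD1 (Ordinal k0))//= ltr_pwDl ?ltr0q ?hl//.
  by apply: sumr_ge0 => i _; rewrite ler0q ltW.
apply: ge_ereal_sup => _ [r _ <-]; apply/lee_addgt0Pr => e e0.
pose eps := e / s.
have eps0 : 0 < eps by rewrite divr_gt0.
(* A point within [rho] of the constant vector [c] has coordinates at least [-1 + eps], so integral
   ones are nonnegative. The closed ball forces the slack [eps]; it costs [s * eps = e]. *)
pose c := rho - 1 + eps.
(* Covering the shifted centre places [x = r + z *m B], in the class of [r], within [rho] of
   [const_mx c]. *)
have [z] := lattice_covering k B (const_mx c - map_mx intr r) k0 B0.
rewrite -/H rho2 opprB addrCA addrA -map_mxD.
set x := r + z *m B => xc.
have xcE i : ((map_mx intr x - const_mx c) : 'rV[R]_k) 0 i = (x 0 i)%:~R - c.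
  by rewrite !mxE.
have x_ge i : 0 <= x 0 i.
  have : ((x 0 i)%:~R - c) ^+ 2 <= rho ^+ 2.
    apply: le_trans xc; rewrite /sqnorm (bigD1 i)//= xcE lerDl.
    by apply: sumr_ge0 => j _; apply: sqr_ge0.
  move=> xc2; have : -1 < (x 0 i)%:~R :> R.
    have : - rho <= (x 0 i)%:~R - c by nra.
    by rewrite /c; lra.
  by rewrite -(rmorphN1 intr) ltr_int; lia.
apply: le_trans (_ : (lprog_cost l x)%:E <= _)%E.
  apply: ereal_inf_lbound; exists x => //; split => //.
  by rewrite LE /x addrC addKr; exists z.
rewrite -EFinD lee_fin.
(* The cost splits into its value at the centre and a deviation of at most [enorm l * rho]. *)
have cost : lprog_cost l x = s * c + \sum_i ratr (l 0 i) * ((x 0 i)%:~R - c).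
  rewrite /lprog_cost /s mulr_suml -big_split/=; apply: eq_bigr => i _.
  by rewrite -mulrDr addrC subrK.
have el0 : 0 <= enorm l :> R by apply: sqrtr_ge0.
have CS : \sum_i ratr (l 0 i) * ((x 0 i)%:~R - c) <= enorm l * rho.
  apply: le_trans (ler_norm _) _.
  rewrite -ler_sqr ?nnegrE ?(mulr_ge0 el0 rho0)// real_normK ?num_real//.
  apply: le_trans (sum_Cauchy_Schwarz _ _ _) _.
  rewrite exprMn /enorm sqr_sqrtr ?sumr_ge0// => [|i _]; last exact: sqr_ge0.
  rewrite ler_wpM2l ?sumr_ge0// => [i _|]; first exact: sqr_ge0.
  by under eq_bigr do rewrite -xcE.
rewrite cost; apply: le_trans (_ : s * c + enorm l * rho <= _).
  by rewrite lerD2l.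
rewrite le_eqVlt; apply/orP; left; apply/eqP.
rewrite /c /eps /rho; field.
by rewrite gt_eqF.
Qed.
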